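(* Let $\mathbb{X}$ be a strictly convex real normed space with $\dim\mathbb{X}\ge 2$, let $x \in S_{\mathbb{X}}$ and $\lambda \in (0, 1)$. If $\beta(\lambda, x) = \min\{\|\lambda x + (1-\lambda) y\|, \| \lambda x - (1-\lambda) y\|\}$ for some $y \in S_{\mathbb{X}}$, then $x \perp_{I} \left(\frac{1-\lambda}{\lambda}\right)y$.
   Context: $S_{\mathbb{X}}$ is the unit sphere of $\mathbb{X}$. $\mathbb{X}$ is strictly convex if every point of $S_{\mathbb{X}}$ is an extreme point of the closed unit ball. Isosceles orthogonality: $x\perp_I y$ means $\|x+y\|=\|x-y\|$. For $\lambda\in(0,1)$ and $x\in S_{\mathbb{X}}$, the generalized local James constant is $\beta(\lambda, x) = \sup\{\min\{\|\lambda x+(1-\lambda)y\|, \|\lambda x - (1-\lambda)y\|\} : y \in S_{\mathbb{X}}\}$. *)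

(* Defs.v *)
From HB Require Import structures.
From mathcomp Require Import all_boot all_order all_algebra.
From mathcomp Require Import all_classical all_reals all_analysis.

Set Implicit Arguments.
Unset Strict Implicit.
Unset Printing Implicit Defensive.

Import Order.TTheory GRing.Theory Num.Theory.
Import numFieldNormedType.Exports.

Local Open Scope classical_set_scope.
Local Open Scope ring_scope.

(* \dim V >= n; V may be infinite-dimensional, so the dimension of a vectType
   cannot be used. *)
Definition dim_ge (R : realType) (V : lmodType R) (n : nat) : Prop :=
  exists v : 'I_n -> V,
    forall c : 'I_n -> R, \sum_(i < n) c i *: v i = 0 -> forall i, c i = 0.

Definition unit_sphere (R : realType) (X : normedModType R) : set X :=
  [set x | `|x| = 1].
Arguments unit_sphere {R} X _.

Definition closed_unit_ball (R : realType) (X : normedModType R) : set X :=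
  [set x | `|x| <= 1].
Arguments closed_unit_ball {R} X _.

Definition extreme_point (R : realType) (V : lmodType R) (A : set V)
    (p : V) : Prop :=
  A p /\
  forall (a b : V) (t : R), A a -> A b -> 0 < t < 1 ->
    p = t *: a + (1 - t) *: b -> a = p /\ b = p.

Definition strictly_convex (R : realType) (X : normedModType R) : Prop :=
  forall x : X, unit_sphere X x -> extreme_point (closed_unit_ball X) x.

Definition isosceles_orthogonal (R : realType) (X : normedModType R) (x y : X)
    : Prop :=
  `|x + y| = `|x - y|.

(* For `|x| = 1 and 0 < lambda < 1 the set is nonempty and bounded by 1, so sup
   never takes its default value 0. *)
Definition local_james (R : realType) (X : normedModType R) (lambda : R)
    (x : X) : R :=
  sup [set Num.min `|lambda *: x + (1 - lambda) *: y|
                   `|lambda *: x - (1 - lambda) *: y| | y in unit_sphere X].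

(* Main.v *)
(** If the two norms differ, we may assume [|a x + b y| < |a x - b y|] with
    [a = lambda], [b = 1 - lambda]. Rotating [y] slightly towards [x] inside the
    plane they span strictly increases [|a x + b y|] (the monotonicity lemma,
    strict by strict convexity), while by continuity [|a x - b y|] stays above
    the old minimum; so the minimum increases, contradicting the maximality of
    [y]. If [y = x] the inequality is impossible, and if [y = - x]
    any nearby unit vector off the line through [x] does better. *)
Require Import Defs.
From HB Require Import structures.
From mathcomp Require Import all_boot all_order all_algebra.
From mathcomp Require Import all_classical all_reals all_analysis.
From mathcomp Require Import ring lra.

Set Implicit Arguments.
Unset Strict Implicit.
Unset Printing Implicit Defensive.

Import Order.TTheory GRing.Theory Num.Theory.
Import numFieldNormedType.Exports.

Local Open Scope classical_set_scope.
Local Open Scope ring_scope.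

(** * Strict triangle inequality, and monotonicity of the norm under rotation in a plane *)

Definition independent (R : realType) (V : lmodType R) (x y : V) : Prop :=
  forall c d : R, c *: x + d *: y = 0 -> c = 0 /\ d = 0.

(** The normalized sum is a convex combination of [u / |u|] and [v / |v|], with weights proportional
    to [|u|] and [|v|]. Under equality it is a unit vector, so extremality makes both normalized
    vectors coincide with it. *)
Lemma strictly_convex_normD (R : realType) (X : normedModType R) (u v : X) :
  strictly_convex X -> u != 0 -> v != 0 -> `|u + v| = `|u| + `|v| ->
  `|v| *: u = `|u| *: v.
Proof.
move=> sc u0 v0 uv.
have pu : 0 < `|u| by rewrite normr_gt0.
have pv : 0 < `|v| by rewrite normr_gt0.
have ps : 0 < `|u| + `|v| by lra.
have nu : `|u| != 0 by rewrite gt_eqF.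
have nv : `|v| != 0 by rewrite gt_eqF.
have ns : `|u| + `|v| != 0 by rewrite gt_eqF.
have unit_inv (w : X) : `|w| != 0 -> `| `|w|^-1 *: w| = 1.
  by move=> w0; rewrite normrZ ger0_norm ?invr_ge0// mulVf.
pose e := (`|u| + `|v|)^-1 *: (u + v).
have e1 : unit_sphere X e by rewrite /unit_sphere /= /e -uv unit_inv// uv.
have [_ /(_ (`|u|^-1 *: u) (`|v|^-1 *: v) (`|u| / (`|u| + `|v|)))] := sc e e1.
rewrite /closed_unit_ball /= !unit_inv// lexx => /(_ isT isT) [].
- by rewrite divr_gt0//= ltr_pdivrMr//; lra.
- rewrite /e scalerDr !scalerA; congr (_ *: _ + _ *: _).
    by field; rewrite nu ns.
  by field; rewrite nv ns.
move=> <- /(congr1 (fun w => (`|u| * `|v|) *: w)).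
by rewrite !scalerA mulfK// mulrAC mulfV// mul1r => ->.
Qed.

Lemma lincombD (R : realType) (V : lmodType R) (x y : V) (c1 d1 c2 d2 : R) :
  (c1 + c2) *: x + (d1 + d2) *: y = (c1 *: x + d1 *: y) + (c2 *: x + d2 *: y).
Proof. by rewrite !scalerDl addrACA. Qed.

Lemma norm_lincombZ (R : realType) (X : normedModType R) (x y : X) (k c d : R) :
  0 <= k -> `|(k * c) *: x + (k * d) *: y| = k * `|c *: x + d *: y|.
Proof. by move=> k0; rewrite -!scalerA -scalerDr normrZ ger0_norm. Qed.

(** A nonzero determinant of the coordinates means that the two vectors are not parallel, whereas
    equality of the norms would make them proportional. *)
Lemma ltr_norm_lincombD (R : realType) (X : normedModType R) (x y : X)
    (c1 d1 c2 d2 : R) :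
  strictly_convex X -> independent x y -> c1 * d2 != c2 * d1 ->
  `|(c1 + c2) *: x + (d1 + d2) *: y| <
    `|c1 *: x + d1 *: y| + `|c2 *: x + d2 *: y|.
Proof.
move=> sc ind det; rewrite lincombD lt_neqAle ler_normD andbT.
set u := c1 *: x + _; set v := c2 *: x + _.
have u0 : u != 0.
  by apply: contra_neq det => /ind[-> ->]; rewrite mul0r mulr0.
have v0 : v != 0.
  by apply: contra_neq det => /ind[-> ->]; rewrite mul0r mulr0.
apply: contra_neq det => /(strictly_convex_normD sc u0 v0) E.
have : (`|v| * c1 - `|u| * c2) *: x + (`|v| * d1 - `|u| * d2) *: y = 0.
  rewrite -!mulNr lincombD -!scalerA -!scalerDr -/u -/v E scaleNr.
  by rewrite subrr.
move=> /ind[/subr0_eq Ec /subr0_eq Ed].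
have nv : `|v| != 0 by rewrite normr_eq0.
have nu : `|u| != 0 by rewrite normr_eq0.
apply: (mulfI nv); rewrite mulrA Ec.
by rewrite -mulrA [in LHS]mulrCA -Ed mulrCA.
Qed.

(* The two cases are whether [p = a x + b y] lies in the triangle with vertices
   [0], [a x], [q = a x + b z], or the segments [0 q] and [(a x) p] cross, where
   [z] is the normalization of [y + t x]. *)
Lemma ltr_norm_rotate (R : realType) (X : normedModType R) (x y : X)
    (a b t : R) :
  strictly_convex X -> independent x y -> `|x| = 1 -> `|y| = 1 ->
  0 < a -> 0 < b -> 0 < t ->
  `|a *: x + b *: y| <
    `|a *: x + b *: (`|t *: x + y|^-1 *: (t *: x + y))|.
Proof.
move=> sc ind x1 y1 a0 b0 t0.
pose F c d := `|c *: x + d *: y|.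
have Fx c : F c 0 = `|c| by rewrite /F scale0r addr0 normrZ x1 mulr1.
have Fy d : F 0 d = `|d| by rewrite /F scale0r add0r normrZ y1 mulr1.
have FZ k c d : 0 <= k -> F (k * c) (k * d) = k * F c d by exact: norm_lincombZ.
have FD c1 d1 c2 d2 : F (c1 + c2) (d1 + d2) <= F c1 d1 + F c2 d2.
  by rewrite /F lincombD ler_normD.
have FS c1 d1 c2 d2 : c1 * d2 != c2 * d1 ->
    F (c1 + c2) (d1 + d2) < F c1 d1 + F c2 d2.
  exact: ltr_norm_lincombD.
set n := `|t *: x + y|.
have nE : n = F t 1 by rewrite /F scale1r.
have n0 : 0 < n.
  rewrite normr_gt0; apply/eqP => /esym E.
  have : t *: x + 1 *: y = 0 by rewrite scale1r E.
  by move=> /ind[_ /eqP]; rewrite oner_eq0.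
have nn : n != 0 by rewrite gt_eqF.
have na : a != 0 by rewrite gt_eqF.
set Q := `|a *: x + b *: (n^-1 *: _)|.
(* With [q = a x + b z], this is the identity [n q = (n a + b t) x + b y], which clears the
   denominator of [z]. *)
have QE : n * Q = F (n * a + b * t) b.
  have -> : F (n * a + b * t) b = F (n * (a + b * t / n)) (n * (b / n)).
    by congr F; field.
  rewrite FZ ?ltW//; congr (_ * _); congr (`| _ |).
  by rewrite !scalerDr !scalerA scalerDl -addrA; congr (_ + (_ *: _ + _)); ring.
rewrite -/(F a b).
have bt0 : 0 < b * t by rewrite mulr_gt0.
(* Triangle case: [p = (a - b t - n a) x + n q], with nonnegative coefficients. *)
have [al0|al0] := leP 0 (a - b * t - n * a).
  have P_le : F a b <= (a - b * t - n * a) + n * Q.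
    rewrite QE -[X in X + _](ger0_norm al0) -Fx.
    by apply: le_trans (FD _ _ _ _); rewrite le_eqVlt; apply/orP/or_introl/eqP;
      congr F; ring.
  have tn : 1 <= t + n.
    have := FD (- t) 0 t 1; rewrite addNr add0r Fy Fx normr1 normrN -nE.
    by rewrite (gtr0_norm t0).
  (* Strict triangle inequality for [n a x = n q - n b z], that is, [a < Q + b]. *)
  have : n * a < n * Q + n * b.
    have Fn : F (- (b * t)) (- b) = n * b.
      by rewrite nE [RHS]mulrC -FZ ?ltW// mulr1 /F !scaleNr -opprD normrN.
    have := FS (n * a + b * t) b (- (b * t)) (- b).
    rewrite addrK subrr Fx gtr0_norm ?mulr_gt0// QE Fn; apply.
    rewrite -subr_eq0.
    have -> : (n * a + b * t) * - b - - (b * t) * b = - (n * a * b) by ring.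
    by rewrite oppr_eq0 !mulf_neq0// gt_eqF.
  rewrite -mulrDr ltr_pM2l// => aQ.
  have n1 : 0 < 1 - n by rewrite subr_gt0 -(ltr_pM2r a0); lra.
  have : 0 <= b * (t + n - 1) by rewrite mulr_ge0 ?(ltW b0)//; lra.
  have : 0 < (1 - n) * (Q + b - a) by rewrite mulr_gt0//; lra.
  lra.
(* Crossing case. With [s = n a + b t], [H1] comes from [s p = a n q + (s - a) b y] and [H2] from
   [s n b z = b t n q + a n b y]. Eliminating [b] through [H3] leaves [s |p| < s Q]. *)
have S1 : n * a + b * t > a by lra.
have H1 : (n * a + b * t) * F a b < a * (n * Q) + (n * a + b * t - a) * b.
  have := FS (a * (n * a + b * t)) (a * b) 0 ((n * a + b * t - a) * b).
  rewrite (FZ a) ?ltW// -QE Fy (ger0_norm (mulr_ge0 _ (ltW b0))); last by lra.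
  rewrite addr0 -mulrDl [a * (_ + _)]mulrC addrCA subrr addr0 FZ; last by lra.
  apply; rewrite mul0r mulf_neq0// ?mulf_neq0 ?gt_eqF//; lra.
have H2 : (n * a + b * t) * (b * n) <= b * t * (n * Q) + a * (n * b).
  have := FD (b * t * (n * a + b * t)) (b * t * b) 0 (a * (n * b)).
  rewrite (FZ (b * t) _ _ (ltW bt0)) -QE Fy (@ger0_norm _ (a * _)); last first.
    by rewrite !mulr_ge0 ?ltW.
  apply: le_trans; rewrite nE mulrA -FZ -?nE; last by rewrite mulr_ge0; lra.
  by rewrite le_eqVlt; apply/orP/or_introl/eqP; congr F; ring.
have H3 : (n * a + b * t - a) * b <= b * t * Q.
  by rewrite -(ler_pM2l n0); lra.
have : (n * a + b * t) * F a b < (n * a + b * t) * Q by lra.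
by rewrite ltr_pM2l//; lra.
Qed.

(** * Independent vectors and small rotations *)

Lemma independent_unit (R : realType) (X : normedModType R) (x y : X) :
  `|x| = 1 -> `|y| = 1 -> y != x -> y != - x -> independent x y.
Proof.
move=> x1 y1 yx yNx c d E.
have Ecd : c *: x = - (d *: y) by apply/eqP; rewrite -addr_eq0 E.
have : `|c| = `|d|.
  by have := congr1 Num.norm Ecd; rewrite normrN !normrZ x1 y1 !mulr1.
have [->|d0] := eqVneq d 0; first by rewrite normr0 => /normr0_eq0.
move=> /eqP; rewrite eqr_norm2 => /orP[] /eqP cd; exfalso.
- move: Ecd; rewrite cd -scalerN => /(scalerI d0) xy.
  by move: yNx; rewrite xy opprK eqxx.
- move: Ecd; rewrite cd scaleNr => /oppr_inj/(scalerI d0) xy.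
  by move: yx; rewrite xy eqxx.
Qed.

Lemma exists_independent (R : realType) (V : lmodType R) (x : V) :
  dim_ge V 2 -> x != 0 -> exists w : V, independent x w.
Proof.
move=> [v vfree] x0; apply: contrapT => /forallNP dep.
have colin w : exists k, w = k *: x.
  apply: contrapT => /forallNP wx; apply: (dep w) => c d E.
  have d0 : d = 0.
    apply: contrapT => /eqP d0; apply: (wx (- (d^-1 * c))).
    apply: (scalerI d0); rewrite scalerA mulrN mulVKf// scaleNr.
    by apply/eqP; rewrite -addr_eq0 addrC E.
  split=> //; move/eqP: E; rewrite d0 scale0r addr0 scaler_eq0 (negPf x0) orbF.
  by move/eqP.
have [[k0 E0] [k1 E1]] := (colin (v ord0), colin (v ord_max)).
have rel c0 c1 : c0 * k0 + c1 * k1 = 0 -> c0 = 0 /\ c1 = 0.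
  move=> E; pose c (i : 'I_2) := if i == ord0 then c0 else c1.
  have := vfree c; rewrite big_ord_recl big_ord1.
  have -> : lift ord0 ord0 = ord_max :> 'I_2 by exact: val_inj.
  rewrite /c /= E0 E1 !scalerA -scalerDl E scale0r => /(_ erefl) cE.
  by split; [exact: cE ord0 | exact: cE ord_max].
(* If every vector were a multiple of [x], the coefficients [(k1, - k0)] would kill the free pair,
   so [k0 = k1 = 0]; then [(1, 0)] kills it too. *)
have [k10 /eqP] : k1 = 0 /\ - k0 = 0 by apply: rel; ring.
rewrite oppr_eq0 => /eqP k00.
have [/eqP] : 1 = 0 :> R /\ 0 = 0 :> R by apply: rel; rewrite k10 k00; ring.
by rewrite oner_eq0.
Qed.

(* With [n = |t w + y|], [y] moves by at most [2 t / n], and [n >= 1 - t]. *)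
Lemma normalize_near (R : realType) (X : normedModType R) (y w : X) (t : R) :
  `|y| = 1 -> `|w| = 1 -> 0 < t -> t <= 2^-1 ->
  `| `|t *: w + y|^-1 *: (t *: w + y)| = 1 /\
  `| `|t *: w + y|^-1 *: (t *: w + y) - y| <= 4 * t.
Proof.
move=> y1 w1 t0 t2; set n := `|t *: w + y|.
have tw : `|t *: w| = t by rewrite normrZ w1 mulr1 gtr0_norm.
have n_le : n <= t + 1 by rewrite -[X in X + _]tw -y1 ler_normD.
have n_ge : 1 <= n + t.
  by have := ler_normB (t *: w + y) (t *: w); rewrite addrAC subrr add0r tw y1.
have n0 : 0 < n by lra.
have nn : n != 0 by rewrite gt_eqF.
split; first by rewrite normrZ ger0_norm ?invr_ge0 ?ltW// mulVf.
have -> : n^-1 *: (t *: w + y) - y = n^-1 *: (t *: w + (1 - n) *: y).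
  apply: (scalerI nn); rewrite scalerBr !scalerA divff// !scale1r.
  by rewrite scalerBl scale1r addrA.
rewrite normrZ ger0_norm ?invr_ge0 ?(ltW n0)// mulrC ler_pdivrMr//.
apply: le_trans (ler_normD _ _) _; rewrite tw normrZ y1 mulr1.
have : `|1 - n| <= t by rewrite ler_norml; lra.
nra.
Qed.

(* Strictly convex case of [| |ax| - |bz| | <= |ax + b z|], with [z] the
   normalization of [t w - x]. *)
Lemma ltr_norm_rotate_opp (R : realType) (X : normedModType R) (x w : X)
    (a b t : R) :
  strictly_convex X -> independent x w -> `|x| = 1 -> 0 < a -> 0 < b -> 0 < t ->
  `|a *: x + b *: (- x)| <
    `|a *: x + b *: (`|t *: w - x|^-1 *: (t *: w - x))|.
Proof.
move=> sc ind x1 a0 b0 t0.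
set n := `|t *: w - x|.
have n0 : 0 < n.
  rewrite normr_gt0; apply/eqP => E.
  have : (- 1) *: x + t *: w = 0 by rewrite scaleN1r addrC.
  by move=> /ind[/eqP]; rewrite oppr_eq0 oner_eq0.
have nn : n != 0 by rewrite gt_eqF.
set z := n^-1 *: (t *: w - x).
have zE k : k *: z = (- (k / n)) *: x + (k * t / n) *: w.
  rewrite /z scalerA scalerBr scalerA scaleNr addrC; congr (_ + _ *: _).
  by ring.
have z1 : `|z| = 1 by rewrite /z normrZ ger0_norm ?invr_ge0 ?ltW// mulVf.
have kz k : 0 < k -> `|k *: z| = k by move=> k0; rewrite normrZ z1 mulr1 gtr0_norm.
have kx k : 0 < k -> `|k *: x| = k by move=> k0; rewrite normrZ x1 mulr1 gtr0_norm.
have det : a * b * t / n != 0 by rewrite gt_eqF// divr_gt0// !mulr_gt0.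
have qE : a *: x + b *: z = (a - b / n) *: x + (b * t / n) *: w.
  by rewrite zE addrA -scalerDl.
(* [A] and [B] split [a x = (a x + b z) - b z] and [b z = (a x + b z) - a x]; together they bound
   [|a - b|] strictly. *)
have A : a < `|a *: x + b *: z| + b.
  have := ltr_norm_lincombD (c1 := a - b / n) (d1 := b * t / n)
    (c2 := b / n) (d2 := - (b * t / n)) sc ind.
  rewrite subrK subrr scale0r addr0 kx// -qE.
  have -> : (b / n) *: x + - (b * t / n) *: w = - (b *: z).
    by rewrite zE !scaleNr opprD opprK.
  rewrite normrN kz//; apply; rewrite -subr_eq0.
  have -> : (a - b / n) * - (b * t / n) - b / n * (b * t / n) =
            - (a * b * t / n) by ring.
  by rewrite oppr_eq0.
have B : b < `|a *: x + b *: z| + a.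
  have := ltr_norm_lincombD (c1 := a - b / n) (d1 := b * t / n)
    (c2 := - a) (d2 := 0) sc ind.
  rewrite addrAC subrr add0r addr0 -zE kz// -qE scale0r addr0 scaleNr normrN.
  rewrite kx//; apply; rewrite -subr_eq0.
  by have -> : (a - b / n) * 0 - - a * (b * t / n) = a * b * t / n by ring.
by rewrite scalerN -scalerBl normrZ x1 mulr1 ltr_norml; lra.
Qed.

(** * The maximality argument *)

Lemma local_james_ge (R : realType) (X : normedModType R) (l : R) (x z : X) :
  `|x| = 1 -> 0 < l < 1 -> `|z| = 1 ->
  Num.min `|l *: x + (1 - l) *: z| `|l *: x - (1 - l) *: z| <= local_james l x.
Proof.
move=> x1 /andP[l0 l1] z1; apply: ub_le_sup; last by exists z.
exists 1 => _ [w w1 <-]; rewrite ge_min; apply/orP; left.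
apply: le_trans (ler_normD _ _) _; rewrite !normrZ x1 w1 !gtr0_norm; lra.
Qed.

(** One half of the desired equality; replacing [y] by [- y] swaps the two norms and gives the other
    half. *)
Lemma ler_norm_of_local_james (R : realType) (X : normedModType R)
    (x y : X) (l : R) :
  strictly_convex X -> dim_ge X 2 -> `|x| = 1 -> `|y| = 1 -> 0 < l < 1 ->
  local_james l x <= `|l *: x + (1 - l) *: y| ->
  `|l *: x - (1 - l) *: y| <= `|l *: x + (1 - l) *: y|.
Proof.
move=> sc dimX x1 y1 l01 jP; have /andP[l0 l1] := l01.
have b0 : 0 < 1 - l by lra.
rewrite leNgt; apply/negP => PM.
have [w w1 incr] : exists2 w : X, `|w| = 1 & forall t, 0 < t ->
    `|l *: x + (1 - l) *: y| <
    `|l *: x + (1 - l) *: (`|t *: w + y|^-1 *: (t *: w + y))|.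
  have [yNx|yNx] := eqVneq y (- x).
    have x0 : x != 0 by rewrite -normr_eq0 x1 oner_eq0.
    have [w ind] := exists_independent dimX x0.
    have w0 : `|w| != 0.
      rewrite normr_eq0; apply/eqP => w0.
      have : 0 *: x + 1 *: w = 0 by rewrite w0 scale0r scaler0 addr0.
      by move=> /ind[_ /eqP]; rewrite oner_eq0.
    exists (`|w|^-1 *: w).
      by rewrite normrZ ger0_norm ?invr_ge0// mulVf.
    move=> t t0; rewrite yNx; apply: ltr_norm_rotate_opp => // c d.
    rewrite scalerA => /ind[-> /eqP]; rewrite mulf_eq0 invr_eq0 (negPf w0) orbF.
    by move=> /eqP.
  exists x => // t t0; apply: ltr_norm_rotate => //.
  (* [y = x] is excluded by [PM]: the norms would be [1] and [|2 l - 1| <= 1]. *)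
  apply: independent_unit => //; apply: contraTneq PM => ->; rewrite -leNgt.
  rewrite -scalerDl -scalerBl !normrZ x1 !mulr1 [l + (1 - l)]addrC subrK normr1.
  by rewrite ler_norml; lra.
set P := `|l *: x + _| in jP PM incr; set M := `|l *: x - _| in PM.
(* The rotation moves [y] by at most [4 t <= (M - P) / 2], so the second norm stays above [P]; the
   cap [2^-1] is what [normalize_near] requires. *)
pose t := Num.min 2^-1 ((M - P) / 8).
have t0 : 0 < t by rewrite lt_min; apply/andP; split; lra.
have t2 : t <= 2^-1 by rewrite ge_min lexx.
have tM : t <= (M - P) / 8 by rewrite ge_min lexx orbT.
have := incr t t0; have [] := normalize_near y1 w1 t0 t2.
set z := _ *: (t *: w + y) => z1 zy Pz.
have Mz : P < `|l *: x - (1 - l) *: z|.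
  have : M <= `|l *: x - (1 - l) *: z| + (1 - l) * `|z - y|.
    rewrite -[X in X * _](gtr0_norm b0) -normrZ.
    by apply: le_trans (ler_normD _ _); rewrite scalerBr addrA subrK lexx.
  nra.
have := le_trans (local_james_ge x1 l01 z1) jP.
by rewrite leNgt lt_min Pz Mz.
Qed.

Theorem theorem2p3 (R : realType) (X : normedModType R)
    (hX : strictly_convex X) (hdim : dim_ge X 2)
    (x : X) (hx : unit_sphere X x) (lambda : R) (hl : 0 < lambda < 1)
    (y : X) (hy : unit_sphere X y)
    (hbeta : local_james lambda x =
       Num.min `|lambda *: x + (1 - lambda) *: y|
               `|lambda *: x - (1 - lambda) *: y|) :
  isosceles_orthogonal x (((1 - lambda) / lambda) *: y).
Proof.
have l0 : 0 < lambda by case/andP: hl.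
(* Multiplying the orthogonality equation by [lambda] clears the quotient. *)
suff E : `|lambda *: x + (1 - lambda) *: y| = `|lambda *: x - (1 - lambda) *: y|.
  have norm_l (v : X) : lambda * `|v| = `|lambda *: v|.
    by rewrite normrZ gtr0_norm.
  apply: (mulfI (lt0r_neq0 l0)); rewrite !norm_l scalerBr scalerDr scalerA.
  by rewrite [_ * (_ / _)]mulrC divfK ?lt0r_neq0.
apply/eqP; rewrite eq_le; apply/andP; split.
- have := @ler_norm_of_local_james R X x (- y) lambda hX hdim hx.
  rewrite !scalerN opprK normrN; apply => //.
  by rewrite hbeta ge_min lexx orbT.
- by apply: ler_norm_of_local_james => //; rewrite hbeta ge_min lexx.
Qed.
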